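(* Let $\mathcal{M}=(E,\mathcal{L})$ be a simple COM of rank $r$ on a finite ground set $E$ with $|E|=n$, and let $R\in\{+\}^E$ be the all-plus sign vector. If for every $C\subseteq E$ with $|C|=r+1$ the sign vector $R\setminus(E\setminus C)$ is a tope of the contraction $\mathcal{M}/(E\setminus C)$, then $R$ is a tope of $\mathcal{M}$.
   Context: Sign vectors on a finite set $E$ are elements of $\{0,+,-\}^E$. For $X,Y$ the composition is $(X\circ Y)_e=X_e$ if $X_e\neq 0$ and $(X\circ Y)_e=Y_e$ otherwise; the separator is $S(X,Y)=\{e\in E: X_e=-Y_e\neq 0\}$. A COM (complex of oriented matroids) is a pair $\mathcal{M}=(E,\mathcal{L})$, $\mathcal{L}\subseteq\{0,+,-\}^E$, satisfying (FS) face symmetry: for all $X,Y\in\mathcal{L}$, $X\circ(-Y)\in\mathcal{L}$; and (SE) strong elimination: for all $X,Y\in\mathcal{L}$ and $e\in S(X,Y)$ there is $Z\in\mathcal{L}$ with $Z_e=0$ and $Z_f=(X\circ Y)_f$ for all $f\in E\setminus S(X,Y)$. Elements of $\mathcal{L}$ are covectors. $\mathcal{M}$ is simple if $\{X_e: X\in\mathcal{L}\}=\{+,-,0\}$ for every $e\in E$ and $\{X_eX_f: X\in\mathcal{L}\}=\{+,-,0\}$ for all $e\neq f$. A tope is a covector with no zero entries. For $F\subseteq E$ and a sign vector $X$, the restriction $X\setminus F\in\{0,+,-\}^{E\setminus F}$ is $X$ restricted to the coordinates in $E\setminus F$; for a set $\mathcal{L}$ of sign vectors, $\mathcal{L}\setminus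 F=\{X\setminus F: X\in\mathcal{L}\}$. The contraction is $\mathcal{M}/F=(E\setminus F,\mathcal{L}/F)$ with $\mathcal{L}/F=\{X\setminus F: X\in\mathcal{L},\ X_e=0 \text{ for all } e\in F\}$ (a COM again); its topes are its covectors with no zero entries. The rank of $\mathcal{M}$ is $r(\mathcal{M})=\max\{|A|: A\subseteq E,\ \mathcal{L}\setminus(E\setminus A)=\{0,+,-\}^{A}\}$. *)

(* Defs.v *)
From HB Require Import structures.
From mathcomp Require Import all_boot.

Set Implicit Arguments.
Unset Strict Implicit.
Unset Printing Implicit Defensive.

Inductive sign := Zero | Pos | Neg.

Definition sign_code (s : sign) : option bool :=
  match s with Zero => None | Pos => Some true | Neg => Some false end.
Definition sign_decode (o : option bool) : sign :=
  match o with None => Zero | Some true => Pos | Some false => Neg end.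
Lemma sign_codeK : cancel sign_code sign_decode.
Proof. by case. Qed.
HB.instance Definition _ := Finite.copy sign (can_type sign_codeK).

Definition sopp (s : sign) : sign :=
  match s with Zero => Zero | Pos => Neg | Neg => Pos end.

Definition smul (s t : sign) : sign :=
  match s with Zero => Zero | Pos => t | Neg => sopp t end.

Notation signvec E := {ffun E -> sign}.

Section SignVectors.

Variable E : finType.
Implicit Types (X Y Z : signvec E) (L : {set signvec E}) (F : {set E}).

Definition svopp X : signvec E := [ffun e => sopp (X e)].

Definition svcomp X Y : signvec E :=
  [ffun e => if X e != Zero then X e else Y e].

Definition separator X Y : {set E} :=
  [set e | (X e == sopp (Y e)) && (X e != Zero)].

Definition face_symmetry L : Prop :=
  forall X Y, X \in L -> Y \in L -> svcomp X (svopp Y) \in L.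

Definition strong_elimination L : Prop :=
  forall X Y (e : E), X \in L -> Y \in L -> e \in separator X Y ->
  exists Z, [/\ Z \in L, Z e = Zero &
    forall f : E, f \notin separator X Y -> Z f = svcomp X Y f].

Definition is_COM L : Prop := face_symmetry L /\ strong_elimination L.

Definition is_simple L : Prop :=
  (forall e : E, [set X e | X : signvec E in L] = [set: sign]) /\
  (forall e f : E, e != f ->
     [set smul (X e) (X f) | X : signvec E in L] = [set: sign]).

Definition topes L : {set signvec E} :=
  [set X in L | [forall e, X e != Zero]].

(* [restrict F X] is X \ F: F is the set of coordinates that are removed. *)
Definition restrict F X : signvec {e : E | e \notin F} :=
  [ffun e => X (val e)].

Definition deletion L F : {set signvec {e : E | e \notin F}} :=
  [set restrict F X | X : signvec E in L].

Definition contraction L F : {set signvec {e : E | e \notin F}} :=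
  [set restrict F X | X : signvec E in L & [forall e in F, X e == Zero]].

Definition shattered L (A : {set E}) : Prop :=
  deletion L (~: A) = [set: signvec {e : E | e \notin ~: A}].

(* The rank is given as a relation because the maximum does not exist when L  *)
(* is empty (no set, not even set0, is shattered): an empty L has no rank.    *)
Definition has_rank L (r : nat) : Prop :=
  (exists2 A : {set E}, shattered L A & #|A| = r) /\
  (forall A : {set E}, shattered L A -> #|A| <= r).

End SignVectors.

Definition allplus (E : finType) : signvec E := [ffun=> Pos].

(* Main.v *)
Require Import Defs.
From mathcomp Require Import all_boot.

(** The face symmetry axiom makes [L] closed under composition, since
    X o Y = X o -(X o -Y).  If |E| > r, every element lies in some C of size
    r + 1, so R is a composition of the covectors that are + on such a C and 0
    elsewhere.  If |E| <= r, the set shattered by the definition of the rank is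
    E itself, and then every sign vector is a covector. *)

Lemma face_symmetry_svcomp {E : finType} {L : {set signvec E}} (X Y : signvec E) :
  face_symmetry L -> X \in L -> Y \in L -> svcomp X Y \in L.
Proof.
move=> symL XL YL.
suff -> : svcomp X Y = svcomp X (svopp (svcomp X (svopp Y))).
  by do 2![apply: (symL) => //].
by apply/ffunP=> e; rewrite !ffunE; case: (X e) => //; case: (Y e).
Qed.

(** The removed set [~: setT] is empty, so restriction loses no coordinate and equal restrictions
    force [X = Y]. *)
Lemma shattered_setT {E : finType} {L : {set signvec E}} (X : signvec E) :
  shattered L setT -> X \in L.
Proof.
move=> shL; have : restrict (~: setT) X \in deletion L (~: setT).
  by rewrite shL inE.
case/imsetP=> Y YL /ffunP eqXY; suff -> : X = Y by [].
have inT e : e \notin ~: [set: E] by rewrite !inE.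
by apply/ffunP=> e; have := eqXY (exist _ e (inT e)); rewrite !ffunE.
Qed.

(** A covector of [L] witnessing membership in the contraction vanishes off [C] and is [Pos] on [C],
    which fixes all its entries. *)
Lemma tope_contraction_allplusP {E : finType} {L : {set signvec E}} (C : {set E}) :
  restrict (~: C) (allplus E) \in topes (contraction L (~: C)) ->
  [ffun e => if e \in C then Pos else Zero] \in L.
Proof.
rewrite inE => /andP[/imsetP[X]]; rewrite inE => /andP[XL /forallP X0].
move=> /ffunP eqX _; suff -> : [ffun e => if e \in C then Pos else Zero] = X by [].
apply/ffunP=> e; rewrite ffunE; case: (boolP (e \in C)) => eC.
  have eNC : e \notin ~: C by rewrite inE negbK.
  by have := eqX (exist _ e eNC); rewrite !ffunE.
by have := X0 e; rewrite inE eC => /eqP.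
Qed.

Lemma exists_card_mem {E : finType} (k : nat) (e : E) :
  k < #|E| -> exists2 C : {set E}, e \in C & #|C| = k.+1.
Proof.
elim: k => [_|k IHk ltkE]; first by exists [set e]; rewrite ?cards1 ?set11.
have [C eC cardC] := IHk (ltnW ltkE).
have /set0Pn[f] : ~: C != set0 by rewrite -card_gt0 cardsCs setCK cardC subn_gt0.
rewrite inE => fC.
by exists (f |: C); rewrite ?inE ?eC ?orbT // cardsU1 fC cardC.
Qed.

Theorem mainTheorem1 (E : finType) (n r : nat) (L : {set signvec E})
  (cardE : #|E| = n) (comL : is_COM L) (simpleL : is_simple L)
  (rankL : has_rank L r)
  (topesC : forall C : {set E}, #|C| = r.+1 ->
     restrict (~: C) (allplus E) \in topes (contraction L (~: C))) :
  allplus E \in topes L.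
Proof.
have [symL _] := comL; have [[A shA cardA] _] := rankL.
rewrite inE; apply/andP; split; last by apply/forallP=> e; rewrite ffunE.
have [leEr|ltrE] := leqP #|E| r.
  apply: shattered_setT; suff <- : A = setT by [].
  by apply/eqP; rewrite eqEcard subsetT cardsT cardA.
have plusL (C : {set E}) : #|C| = r.+1 ->
    [ffun e => if e \in C then Pos else Zero] \in L.
  by move=> cardC; apply: tope_contraction_allplusP; apply: topesC.
(* Composition keeps the nonzero entries of its left factor; with [Neg] excluded, each entry of [X]
   is already [Pos] or can still be filled with [Pos]. *)
pose covers (s : seq E) (X : signvec E) :=
  [/\ X \in L, forall e, X e != Neg & forall e, e \in s -> X e = Pos].
have exC s : exists X, covers s X.
  elim: s => [|e s [X [XL XN Xs]]].
    (* Even the empty list calls for a covector without [Neg]; the one that is [Pos] exactly on some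
       [C] of size [r.+1] serves. *)
    have /card_gt0P[e _] : 0 < #|E| by apply: leq_trans ltrE.
    have [C _ cardC] := exists_card_mem r e ltrE.
    exists [ffun e => if e \in C then Pos else Zero]; split => //; first exact: plusL.
    by move=> f; rewrite ffunE; case: ifP.
  have [C eC cardC] := exists_card_mem r e ltrE.
  exists (svcomp X [ffun e => if e \in C then Pos else Zero]); split.
  - by apply: face_symmetry_svcomp => //; apply: plusL.
  - by move=> f; rewrite !ffunE; case: ifP => // _; case: ifP.
  move=> f; rewrite inE !ffunE => /predU1P[->|/Xs -> //].
  by rewrite eC; have := XN e; case: (X e).
have [X [XL _ XP]] := exC (enum E).
suff -> : allplus E = X by [].
by apply/ffunP=> e; rewrite ffunE XP ?mem_enum.
Qed.
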